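(* For every pair of sets $F$ and $G$, let $\mathcal{LO}_{FGac}$ be the class of linearly ordered sets equipped with an $F$-indexed family of order automorphisms and a $G$-indexed family of order antiautomorphisms such that all the operations indexed by $F$ and by $G$ have a common center. Then $\mathcal{LO}_{FGac}$ has the strong amalgamation property.
   Context: An order automorphism of a linear order is a bijection $f$ with $a\le b\iff f(a)\le f(b)$; an order antiautomorphism is a bijection $g$ with $a\le b\iff g(a)\ge g(b)$. A common center is an element $c$ with $h(c)=c$ for every operation $h$ of the structure. Embeddings are injective maps commuting with all operations and satisfying $x\le y\iff\iota(x)\le\iota(y)$. A class $\mathcal K$ closed under isomorphism has the strong amalgamation property (SAP) if whenever $\mathbf A,\mathbf B,\mathbf C\in\mathcal K$ and $\iota_1:\mathbf C\to\mathbf A$, $\iota_2:\mathbf C\to\mathbf B$ are embeddings, there exist $\mathbf D\in\mathcal K$ and embeddings $j_1:\mathbf A\to\mathbf D$, $j_2:\mathbf B\to\mathbf D$ with $j_1\circ\iota_1=j_2\circ\iota_2$ and $j_1(A)\cap j_2(B)=j_1(\iota_1(C))$. *)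

(* Defs.v *)
From HB Require Import structures.
From mathcomp Require Import all_boot all_order.
From mathcomp Require Import boolp classical_sets.

Set Implicit Arguments.
Unset Strict Implicit.
Unset Printing Implicit Defensive.

Import Order.TTheory.

Local Open Scope order_scope.

Definition order_automorphism d (T : orderType d) (f : T -> T) : Prop :=
  bijective f /\ {mono f : a b / a <= b}.

Definition order_antiautomorphism d (T : orderType d) (g : T -> T) : Prop :=
  bijective g /\ {mono g : a b /~ a <= b}.

(* The display is only a notational tag of MathComp orders; keeping it as a
   field lets each structure carry its own. *)
Record lo_struct (F G : Type) := LOStruct {
  lo_disp : Order.disp_t;
  lo_carrier :> orderType lo_disp;
  lo_fop : F -> lo_carrier -> lo_carrier;
  lo_gop : G -> lo_carrier -> lo_carrier
}.

Definition common_center (F G : Type) (A : lo_struct F G) (c : A) : Prop :=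
  (forall f : F, lo_fop f c = c) /\ (forall g : G, lo_gop g c = c).

Definition LO_FGac (F G : Type) (A : lo_struct F G) : Prop :=
  [/\ forall f : F, order_automorphism (@lo_fop F G A f),
      forall g : G, order_antiautomorphism (@lo_gop F G A g)
    & exists c : A, common_center c].

Definition embedding (F G : Type) (A B : lo_struct F G) (i : A -> B) : Prop :=
  [/\ injective i,
      {mono i : x y / x <= y},
      forall (f : F) (x : A), i (lo_fop f x) = lo_fop f (i x)
    & forall (g : G) (x : A), i (lo_gop g x) = lo_gop g (i x)].

Definition closed_under_iso (F G : Type) (K : lo_struct F G -> Prop) : Prop :=
  forall (A B : lo_struct F G) (i : A -> B),
    embedding i -> bijective i -> K A -> K B.

Definition strong_amalgamation (F G : Type) (K : lo_struct F G -> Prop) : Prop :=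
  forall (A B C : lo_struct F G) (i1 : C -> A) (i2 : C -> B),
    K A -> K B -> K C -> embedding i1 -> embedding i2 ->
    exists (D : lo_struct F G) (j1 : A -> D) (j2 : B -> D),
      [/\ K D, embedding j1, embedding j2,
          j1 \o i1 =1 j2 \o i2
        & (range j1 `&` range j2 = j1 @` range i1)%classic].

Lemma LO_FGac_closed_under_iso (F G : Type) : closed_under_iso (@LO_FGac F G).
Proof.
move=> A B i [_ imono ifop igop] [k ik ki] [hf hg [c [cf cg]]].
have kmono : {mono k : x y / x <= y} by move=> x y; rewrite -imono !ki.
have fE f x : lo_fop f x = i (lo_fop f (k x)) by rewrite ifop ki.
have gE g x : lo_gop g x = i (lo_gop g (k x)) by rewrite igop ki.
split.
- move=> f; have [[h hK Kh] fmono] := hf f; split.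
    by exists (i \o h \o k) => x /=; rewrite fE ik ?hK ?Kh ki.
  by move=> x y; rewrite !fE imono fmono kmono.
- move=> g; have [[h hK Kh] gmono] := hg g; split.
    by exists (i \o h \o k) => x /=; rewrite gE ik ?hK ?Kh ki.
  by move=> x y; rewrite !gE imono gmono kmono.
- by exists (i c); split=> [f|g]; rewrite ?fE ?gE ik ?cf ?cg.
Qed.

(* Main.v *)
Require Import Defs.
From HB Require Import structures.
From mathcomp Require Import all_boot all_order.
From mathcomp Require Import boolp classical_sets.

(** The amalgam is the free amalgam [A + (B \ C)], where an element [a] of [A]
  and an element [b] of [B \ C] that are separated by some element of [C] are
  ordered accordingly, and where, if they determine the same cut of [C], [a] is
  put below [b] on the positive side of the center and above [b] on the
  negative side.  Automorphisms preserve the two sides of the center and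
  antiautomorphisms exchange them, so both kinds of operations respect this
  choice. *)

Set Implicit Arguments.
Unset Strict Implicit.
Unset Printing Implicit Defensive.

Import Order.TTheory.

Local Open Scope order_scope.

(** * Gluing two chains along a cut *)

Definition monotone_cut dA dB (A : orderType dA) (B : orderType dB)
    (L : A -> B -> bool) : Prop :=
  forall a a' b b', a' <= a -> b <= b' -> L a b -> L a' b'.

(* [L a b] stands for [a <= b]. *)
Definition glue dA dB (A : orderType dA) (B : orderType dB)
    (P : pred B) (L : A -> B -> bool) & monotone_cut L : Type :=
  (A + {b : B | P b})%type.

Section GlueOrder.
Context dA dB (A : orderType dA) (B : orderType dB).
Context (P : pred B) (L : A -> B -> bool) (Lmono : monotone_cut L).

HB.instance Definition _ := Choice.copy (glue P Lmono) (A + {b : B | P b})%type.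

Definition glue_le (x y : glue P Lmono) : bool :=
  match x, y with
  | inl a, inl a' => a <= a'
  | inl a, inr b => L a (val b)
  | inr b, inl a => ~~ L a (val b)
  | inr b, inr b' => val b <= val b'
  end.

Lemma glue_le_refl : reflexive glue_le.
Proof. by case=> x /=. Qed.

Lemma glue_le_anti : antisymmetric glue_le.
Proof.
case=> x [] y /=; last 1 first.
- by move/le_anti/val_inj ->.
- by move/le_anti ->.
- by case: (L x _).
- by case: (L y _).
Qed.

(** Every mixed case is monotonicity of [L] or its contrapositive. When the outer elements lie in
    the same summand, totality there is used: were they in reverse order, [L] could be transported
    from one to the other. *)
Lemma glue_le_trans : transitive glue_le.
Proof.
case=> y [] x [] z /=.
- exact: le_trans.
- by move=> le_xy; apply: Lmono.
- by move=> nLyx le_yz; apply: contra nLyx; apply: Lmono.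
- move=> nLyx Lyz; rewrite leNgt; apply: contra nLyx => /ltW le_zx.
  exact: Lmono Lyz.
- move=> Lxy nLzy; rewrite leNgt; apply: contra nLzy => /ltW le_zx.
  exact: Lmono Lxy.
- by move=> Lxy le_yz; apply: Lmono Lxy.
- by move=> le_xy; apply: contra; apply: Lmono.
- exact: le_trans.
Qed.

Lemma glue_le_total : total glue_le.
Proof.
case=> x [] y /=; [exact: le_total | exact: orbN | | exact: le_total].
by rewrite orbC orbN.
Qed.

(** The type [glue] carries the monotonicity proof as a parameter, so the order laws can be inferred
    from the type alone. *)
HB.instance Definition _ := Order.Le_isPOrder.Build dA (glue P Lmono)
  glue_le_refl glue_le_anti glue_le_trans.
HB.instance Definition _ :=
  Order.POrder_isTotal.Build dA (glue P Lmono) glue_le_total.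

Lemma glue_leE (x y : glue P Lmono) : (x <= y) = glue_le x y.
Proof. by []. Qed.

Definition glue_map (f : A -> A) (g : B -> B)
    (Pg : forall b, P b -> P (g b)) (x : glue P Lmono) : glue P Lmono :=
  match x with
  | inl a => inl (f a)
  | inr b => inr (exist _ (g (val b)) (Pg _ (valP b)))
  end.

Lemma glue_map_bij f g Pg :
  bijective f -> bijective g -> (forall b, P (g b) -> P b) ->
  bijective (@glue_map f g Pg).
Proof.
move=> [f' fK f'K] [g' gK g'K] gP.
have Pg' b : P b -> P (g' b) by move=> Pb; apply: gP; rewrite g'K.
exists (@glue_map f' g' Pg') => -[a|b] /=; rewrite ?fK ?f'K //;
  by congr inr; apply: val_inj; rewrite /= ?gK ?g'K.
Qed.

End GlueOrder.

Lemma order_automorphism_glue_map dA dB (A : orderType dA) (B : orderType dB)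
    (P : pred B) (L : A -> B -> bool) (Lmono : monotone_cut L) f g Pg :
  order_automorphism f -> order_automorphism g ->
  (forall b, P (g b) -> P b) ->
  (forall a b, P b -> L (f a) (g b) = L a b) ->
  order_automorphism (@glue_map _ _ A B P L Lmono f g Pg).
Proof.
move=> [fbij fmono] [gbij gmono] gP Lfg.
split; first exact: glue_map_bij.
by move=> [a|[b Pb]] [a'|[b' Pb']]; rewrite !glue_leE /= ?fmono ?gmono ?Lfg.
Qed.

Lemma order_antiautomorphism_glue_map dA dB (A : orderType dA)
    (B : orderType dB) (P : pred B) (L : A -> B -> bool)
    (Lmono : monotone_cut L) f g Pg :
  order_antiautomorphism f -> order_antiautomorphism g ->
  (forall b, P (g b) -> P b) ->
  (forall a b, P b -> L (f a) (g b) = ~~ L a b) ->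
  order_antiautomorphism (@glue_map _ _ A B P L Lmono f g Pg).
Proof.
move=> [fbij fmono] [gbij gmono] gP Lfg.
split; first exact: glue_map_bij.
by move=> [a|[b Pb]] [a'|[b' Pb']];
  rewrite !glue_leE /= ?fmono ?gmono ?Lfg ?negbK.
Qed.

(** * The cut determined by separators and the center *)

Section CenterCut.
Context dA dB dC (A : orderType dA) (B : orderType dB) (C : orderType dC).
Context (i1 : C -> A) (i2 : C -> B) (c0 : C).
Hypothesis i1mono : {mono i1 : x y / x <= y}.
Hypothesis i2mono : {mono i2 : x y / x <= y}.

Definition sep_le (a : A) (b : B) : Prop := exists c, a <= i1 c /\ i2 c <= b.

Definition sep_ge (a : A) (b : B) : Prop := exists c, b <= i2 c /\ i1 c <= a.

(** The side of the center is read off [a] alone: when [b] lies on the other side, [c0] itself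
    separates the two. *)
Definition center_cut (a : A) (b : B) : bool :=
  `[< sep_le a b \/ (i1 c0 <= a /\ ~ sep_ge a b) >].

Lemma center_cut_monotone : monotone_cut center_cut.
Proof.
move=> a a' b b' le_a le_b /asboolP H; apply/asboolP.
case: H => [[c [ac cb]]|[c0a nsep]].
  by left; exists c; split; [apply: le_trans ac | apply: le_trans le_b].
have [c0a'|/ltW a'c0] := leP (i1 c0) a'.
  right; split=> // -[c [b'c ca']]; apply: nsep; exists c.
  by split; [apply: le_trans b'c | apply: le_trans le_a].
(* Here [a'] has dropped below the center. As [b] is not below it, for otherwise [c0] would witness
   [sep_ge a b], the center separates [a'] from [b']. *)
left; exists c0; split=> //; apply: le_trans le_b.
by have [//|/ltW bc0] := leP (i2 c0) b; case: nsep; exists c0.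
Qed.

Lemma center_cut_i1 c b : center_cut (i1 c) b = (i2 c <= b).
Proof.
apply/asboolP/idP => [[[c' [cc' c'b]]|[_ nsep]]|cb].
- by apply: le_trans c'b; rewrite i2mono -i1mono.
- by have [//|/ltW bc] := leP (i2 c) b; case: nsep; exists c.
- by left; exists c.
Qed.

(** The two separators squeeze [b]: comparison through [a] gives [c' <= c], hence
    [b <= i2 c' <= i2 c <= b]. So an element outside the image of [C] is separated from [a] in at
    most one direction. *)
Lemma sep_le_ge a b : sep_le a b -> sep_ge a b -> range i2 b.
Proof.
move=> [c [ac cb]] [c' [bc' c'a]]; exists c => //; apply/le_anti.
rewrite cb /= (le_trans bc') // i2mono -i1mono; exact: le_trans ac.
Qed.

(** Separators are carried forward by [h] and back by its inverse, and the side of the center is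
    kept because [h] fixes [c0]. *)
Lemma center_cut_auto f1 f2 (h : C -> C) :
  order_automorphism f1 -> order_automorphism f2 -> bijective h ->
  (forall c, i1 (h c) = f1 (i1 c)) -> (forall c, i2 (h c) = f2 (i2 c)) ->
  h c0 = c0 ->
  forall a b, center_cut (f1 a) (f2 b) = center_cut a b.
Proof.
move=> [_ f1m] [_ f2m] [h' hK h'K] i1h i2h hc0 a b.
have sle : sep_le (f1 a) (f2 b) <-> sep_le a b.
  split=> -[c [ac cb]]; last first.
    by exists (h c); rewrite i1h i2h f1m f2m.
  by exists (h' c); rewrite -f1m -f2m -i1h -i2h h'K.
have sge : sep_ge (f1 a) (f2 b) <-> sep_ge a b.
  split=> -[c [ac cb]]; last first.
    by exists (h c); rewrite i1h i2h f1m f2m.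
  by exists (h' c); rewrite -f1m -f2m -i1h -i2h h'K.
apply: asbool_equiv_eq; rewrite -{1}hc0 i1h f1m.
by split=> -[/sle|[? /sge]]; [left|right|left|right].
Qed.

(** Antiautomorphisms exchange [sep_le] with [sep_ge] and the two sides of the center, so the
    tie-breaking rule is negated as well. *)
Lemma center_cut_anti g1 g2 (h : C -> C) :
  order_antiautomorphism g1 -> order_antiautomorphism g2 -> bijective h ->
  (forall c, i1 (h c) = g1 (i1 c)) -> (forall c, i2 (h c) = g2 (i2 c)) ->
  h c0 = c0 ->
  forall a b, ~ range i2 b -> center_cut (g1 a) (g2 b) = ~~ center_cut a b.
Proof.
move=> [_ g1m] [_ g2m] [h' hK h'K] i1h i2h hc0 a b nCb.
have sle : sep_le (g1 a) (g2 b) <-> sep_ge a b.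
  split=> -[c [ac cb]]; last first.
    by exists (h c); rewrite i1h i2h g1m g2m.
  by exists (h' c); rewrite -g1m -g2m -i1h -i2h h'K.
have sge : sep_ge (g1 a) (g2 b) <-> sep_le a b.
  split=> -[c [ac cb]]; last first.
    by exists (h c); rewrite i1h i2h g1m g2m.
  by exists (h' c); rewrite -g1m -g2m -i1h -i2h h'K.
rewrite -asbool_neg; apply: asbool_equiv_eq; rewrite -{1}hc0 i1h g1m; split.
- move=> [/sle ge_ab|[ac0 nge]] [le_ab|[c0a nge']] //.
  + exact/nCb/sep_le_ge/ge_ab.
  + exact/nge/sge.
  (* Now [a] is the center itself, and [c0] separates it from [b] in one direction or the other. *)
  + case: (leP b (i2 c0)) => [bc0|/ltW c0b]; first by apply: nge'; exists c0.
    by apply: nge; apply/sge; exists c0.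
- move=> nL; have nle : ~ sep_le a b by move=> le_ab; apply: nL; left.
  have [ge_ab|nge] := pselect (sep_ge a b); first by left; apply/sle.
  right; split; last by move/sge.
  by rewrite leNgt; apply/negP => /ltW c0a; apply: nL; right.
Qed.

End CenterCut.

(** * The amalgam and its two embeddings *)

Section Amalgam.
Context (F G : Type) (A B C : lo_struct F G) (i1 : C -> A) (i2 : C -> B).
Hypotheses (KA : LO_FGac A) (KB : LO_FGac B) (KC : LO_FGac C).
Hypotheses (e1 : embedding i1) (e2 : embedding i2).
Context (c0 : C) (c0P : common_center c0).

Let new : pred B := fun b => `[< ~ range i2 b >].

(** Surjectivity of [h] and injectivity of [k] prevent a new element from being sent into the image
    of [C]. *)
Lemma range_embedding_op (h : C -> C) (k : B -> B) :
  bijective h -> injective k -> (forall c, i2 (h c) = k (i2 c)) ->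
  forall b, new (k b) = new b.
Proof.
move=> [h' hK h'K] kinj i2h b; apply: asbool_equiv_eq.
split=> nC [c _ cb]; apply: nC; first by exists (h c); rewrite // i2h cb.
by exists (h' c) => //; apply: kinj; rewrite -i2h h'K.
Qed.

Lemma new_fop f b : new (lo_fop f b) = new b.
Proof.
have [[hC _ _] [hB _ _] [_ _ e _]] := And3 KC KB e2.
apply: (range_embedding_op (h := lo_fop f)) => //; first by case: (hC f).
by apply: bij_inj; case: (hB f).
Qed.

Lemma new_gop g b : new (lo_gop g b) = new b.
Proof.
have [[_ hC _] [_ hB _] [_ _ _ e]] := And3 KC KB e2.
apply: (range_embedding_op (h := lo_gop g)) => //; first by case: (hC g).
by apply: bij_inj; case: (hB g).
Qed.

Let i1mono : {mono i1 : x y / x <= y}. Proof. by case: e1. Qed.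
Let i2mono : {mono i2 : x y / x <= y}. Proof. by case: e2. Qed.

Let D := glue new (@center_cut_monotone _ _ _ A B C i1 i2 c0).

Lemma new_fop_stable f b : new b -> new (lo_fop f b).
Proof. by rewrite new_fop. Qed.

Lemma new_gop_stable g b : new b -> new (lo_gop g b).
Proof. by rewrite new_gop. Qed.

Definition amalgam : lo_struct F G :=
  @LOStruct F G _ D
    (fun f => glue_map (lo_fop f) (@new_fop_stable f))
    (fun g => glue_map (lo_gop g) (@new_gop_stable g)).

Definition amalgam_inl (a : A) : amalgam := inl a.

Definition amalgam_inr (b : B) : amalgam :=
  match pselect (range i2 b) with
  | left Cb => inl (i1 (sval (cid2 Cb)))
  | right nCb => inr (exist _ b (asboolT nCb))
  end.

Lemma amalgam_inr_i2 c : amalgam_inr (i2 c) = inl (i1 c).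
Proof.
rewrite /amalgam_inr; case: pselect => [Cb|[]]; last by exists c.
by case: cid2 => c' /= _ /(inc_inj i2mono) ->.
Qed.

Lemma amalgam_inr_new b (nb : new b) : amalgam_inr b = inr (exist _ b nb).
Proof.
rewrite /amalgam_inr; case: pselect => [Cb|nCb]; first by case: (asboolW nb).
by congr inr; apply: val_inj.
Qed.

(** Case analysis that hides the preimage chosen by [cid2]. *)
Variant amalgam_inr_spec (b : B) : amalgam -> Prop :=
  | AmalgamInrOld c of b = i2 c : amalgam_inr_spec b (inl (i1 c))
  | AmalgamInrNew (nb : new b) : amalgam_inr_spec b (inr (exist _ b nb)).

Lemma amalgam_inrP b : amalgam_inr_spec b (amalgam_inr b).
Proof.
have [[c _ <-]|nCb] := pselect (range i2 b).
  by rewrite amalgam_inr_i2; constructor.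
have nb : new b by apply/asboolP.
by rewrite (amalgam_inr_new nb); constructor.
Qed.

Lemma amalgam_LO_FGac : LO_FGac amalgam.
Proof.
have [[hAf hAg _] [hBf hBg _] [hCf hCg _]] := And3 KA KB KC.
have [[_ _ f1 g1] [_ _ f2 g2] [c0f c0g]] := And3 e1 e2 c0P.
split=> [f|g|].
- apply: order_automorphism_glue_map => // [b|a b _].
    by rewrite new_fop.
  by apply: (center_cut_auto (h := lo_fop f)) => //; case: (hCf f).
- apply: order_antiautomorphism_glue_map => // [b|a b /asboolP nCb].
    by rewrite new_gop.
  by apply: (center_cut_anti i1mono i2mono (h := lo_gop g)) => //; case: (hCg g).
- by exists (amalgam_inl (i1 c0)); split=> [f|g];
    rewrite /amalgam_inl /= -?f1 -?g1 ?c0f ?c0g.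
Qed.

Lemma amalgam_inl_embedding : embedding amalgam_inl.
Proof. by split=> // a a' []. Qed.

Lemma amalgam_inr_mono : {mono amalgam_inr : x y / x <= y}.
Proof.
move=> b b'; rewrite glue_leE.
case: amalgam_inrP => [c ->|nb]; case: amalgam_inrP => [c' ->|nb'] //=.
- by rewrite i1mono i2mono.
- by rewrite center_cut_i1.
(* The negated cut gives the strict [b < i2 c'], which agrees with [<=] because [b] is outside the
   image of [C]. *)
- rewrite center_cut_i1 // -ltNge lt_neqAle andb_idl // => _.
  by apply/eqP => bc; move/asboolP: nb; apply; exists c'.
Qed.

Lemma amalgam_inr_embedding : embedding amalgam_inr.
Proof.
have [[_ _ f1 g1] [_ _ f2 g2]] := conj e1 e2.
split=> [||f b|g b].
- exact: inc_inj amalgam_inr_mono.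
- exact: amalgam_inr_mono.
- case: (amalgam_inrP b) => [c ->|nb] /=; first by rewrite -f2 amalgam_inr_i2 f1.
  exact: amalgam_inr_new.
- case: (amalgam_inrP b) => [c ->|nb] /=; first by rewrite -g2 amalgam_inr_i2 g1.
  exact: amalgam_inr_new.
Qed.

Lemma amalgam_ranges :
  (range amalgam_inl `&` range amalgam_inr = amalgam_inl @` range i1)%classic.
Proof.
apply/seteqP; split=> [_ [[a _ <-] [b _]]|_ [_ [c _ <-] <-]].
  case: amalgam_inrP => // c _ [<-]; by exists (i1 c) => //; exists c.
by split; [exists (i1 c) | exists (i2 c) => //; rewrite amalgam_inr_i2].
Qed.

End Amalgam.

Theorem theorem4p5 (F G : Type) : strong_amalgamation (@LO_FGac F G).
Proof.
(* The center is taken in [C], so that it can serve as a separator and its images in [A] and [B] are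
   identified. *)
move=> A B C i1 i2 KA KB KC e1 e2; have [_ _ [c0 c0P]] := KC.
exists (amalgam i1 KB KC e2 c0), (@amalgam_inl _ _ A B C i1 i2 KB KC e2 c0),
  (@amalgam_inr _ _ A B C i1 i2 KB KC e2 c0).
split.
- exact: amalgam_LO_FGac.
- exact: amalgam_inl_embedding.
- exact: amalgam_inr_embedding.
- by move=> c /=; rewrite amalgam_inr_i2.
- exact: amalgam_ranges.
Qed.
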